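(* Let $\mathfrak{N}$ be a nest in a vector space $\mathfrak{X}$ over a field $\mathbb{F}$ and let $\mathcal{A}=\operatorname{Alg}\mathfrak{N}$. If $\mathfrak{N}$ is well-ordered (by inclusion), then $\operatorname{Rad}\mathcal{A}=\mathcal{A}_{-}$.
   Context: $\mathfrak{X}$ is an arbitrary vector space over a field $\mathbb{F}$, and $\mathcal{L}(\mathfrak{X})$ is the algebra of all linear operators $\mathfrak{X}\to\mathfrak{X}$. A nest $\mathfrak{N}$ in $\mathfrak{X}$ is a set of subspaces of $\mathfrak{X}$, totally ordered by inclusion, containing $\{0\}$ and $\mathfrak{X}$, and complete, i.e. closed under arbitrary intersections and arbitrary unions of its members (the empty union being $\{0\}$ and the empty intersection being $\mathfrak{X}$). $\operatorname{Alg}\mathfrak{N}$ is the algebra of all $T\in\mathcal{L}(\mathfrak{X})$ with $T(M)\subseteq M$ for every $M\in\mathfrak{N}$. For $x\in\mathfrak{X}$, $\mathfrak{N}(x)_{-}=\bigcup\{M\in\mathfrak{N}:x\notin M\}$ (so $\mathfrak{N}(0)_{-}=\{0\}$). The strictly triangular ideal of $\mathcal{A}=\operatorname{Alg}\mathfrak{N}$ is $\mathcal{A}_{-}=\{T\in\mathcal{A}:Tx\in\mathfrak{N}(x)_{-}\text{ for all }x\in\mathfrak{X}\}$. $\operatorname{Rad}\mathcal{A}$ is the Jacobson radical of $\mathcal{A}$, i.e. the intersection of all maximal left ideals of $\mathcal{A}$. *)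

(* Defs.v *)
From HB Require Import structures.
From mathcomp Require Import all_boot all_algebra.
From mathcomp Require Import boolp classical_sets wochoice.

Set Implicit Arguments.
Unset Strict Implicit.
Unset Printing Implicit Defensive.

Import GRing.Theory.
Local Open Scope classical_set_scope.
Local Open Scope ring_scope.

Section Endomorphisms.
Context {F : fieldType} {X : lmodType F}.

(* The ring L(X); its product is composition. *)
Definition endo : Type := {linear X -> X}.

HB.instance Definition _ := gen_eqMixin endo.
HB.instance Definition _ := gen_choiceMixin endo.

Lemma endoP (S T : endo) : (forall x, S x = T x) -> S = T.
Proof.
move=> eST; case: S T eST => [s [[sD] [sZ]]] [t [[tD] [tZ]]] /= /funext e.
case: _ / e tD tZ => tD tZ.
by rewrite (Prop_irrelevance sD tD) (Prop_irrelevance sZ tZ).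
Qed.

Definition endo_zero : endo := \0.
Definition endo_one : endo := idfun.
Definition endo_opp (T : endo) : endo := \- T.
Definition endo_add (S T : endo) : endo := S \+ T.
Definition endo_mul (S T : endo) : endo := S \o T.

Fact endo_addA : associative endo_add.
Proof. by move=> R S T; apply: endoP => x; exact: addrA. Qed.
Fact endo_addC : commutative endo_add.
Proof. by move=> S T; apply: endoP => x; exact: addrC. Qed.
Fact endo_add0 : left_id endo_zero endo_add.
Proof. by move=> T; apply: endoP => x; exact: add0r. Qed.
Fact endo_addN : left_inverse endo_zero endo_opp endo_add.
Proof. by move=> T; apply: endoP => x; exact: addNr. Qed.

HB.instance Definition _ :=
  GRing.isZmodule.Build endo endo_addA endo_addC endo_add0 endo_addN.

Fact endo_mulA : associative endo_mul.
Proof. by move=> R S T; exact: endoP. Qed.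
Fact endo_mul1l : left_id endo_one endo_mul.
Proof. by move=> T; exact: endoP. Qed.
Fact endo_mul1r : right_id endo_one endo_mul.
Proof. by move=> T; exact: endoP. Qed.
Fact endo_mulDl : left_distributive endo_mul endo_add.
Proof. by move=> R S T; exact: endoP. Qed.
Fact endo_mulDr : right_distributive endo_mul endo_add.
Proof. by move=> R S T; apply: endoP => x; exact: linearD. Qed.

(* pzRing: the ring is trivial when X is. *)
HB.instance Definition _ := GRing.Zmodule_isPzRing.Build endo
  endo_mulA endo_mul1l endo_mul1r endo_mulDl endo_mulDr.

Lemma endo0E x : (0 : endo) x = 0. Proof. by []. Qed.
Lemma endo1E x : (1 : endo) x = x. Proof. by []. Qed.
Lemma endoNE (T : endo) x : (- T) x = - T x. Proof. by []. Qed.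
Lemma endoDE (S T : endo) x : (S + T) x = S x + T x. Proof. by []. Qed.
Lemma endoME (S T : endo) x : (S * T) x = S (T x). Proof. by []. Qed.

End Endomorphisms.
Arguments endo {F} X.

(* The ring under consideration is a subring A of an ambient ring R; its left
   ideals are represented as subsets of R contained in A. *)
Section JacobsonRadical.
Context {R : pzRingType}.
Implicit Types A I J : set R.

Definition left_ideal A I : Prop :=
  [/\ I `<=` A, I 0,
      forall x y, I x -> I y -> I (x - y)
    & forall a x, A a -> I x -> I (a * x)].

Definition maximal_left_ideal A I : Prop :=
  [/\ left_ideal A I, I <> A
    & forall J, left_ideal A J -> I `<=` J -> J = I \/ J = A].

(* Intersecting with A only matters when A is trivial: the intersection over
   the empty family of maximal left ideals is then A. *)
Definition jacobson_radical A : set R :=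
  A `&` \bigcap_(I in maximal_left_ideal A) I.

End JacobsonRadical.

Section Nests.
Context {F : fieldType} {X : lmodType F}.
Implicit Types (N C : set (set X)) (M : set X).

(* Union of a family of subspaces, the empty union being {0}; for a nonempty
   family of subspaces the first term is redundant. *)
Definition union_subspaces C : set X := [set 0] `|` \bigcup_(M in C) M.

Definition nest N : Prop :=
  [/\ forall M, N M -> submod_closed [in M],
      total_on N subset,
      N [set 0] /\ N [set: X],
      forall C, C `<=` N -> N (\bigcap_(M in C) M)
    & forall C, C `<=` N -> N (union_subspaces C)].

Definition well_ordered N : Prop :=
  wo_chain (fun M M' : set X => `[< M `<=` M' >]) [in N].

Definition Alg N : set (endo X) :=
  [set T : endo X | forall M, N M -> T @` M `<=` M].

(* N(x)_- *)
Definition nest_pred N (x : X) : set X :=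
  union_subspaces [set M | N M /\ ~ M x].

(* A_- for A = Alg N *)
Definition strictly_triangular N : set (endo X) :=
  [set T : endo X | Alg N T /\ forall x, nest_pred N x (T x)].

Lemma Alg_subring N : nest N -> subring_closed [in Alg N].
Proof.
move=> [Nsub _ _ _ _]; split.
- by rewrite inE => M NM _ [x Mx <-].
- move=> S T; rewrite !inE => AS AT M NM _ [x Mx <-].
  have /GRing.submod_closedB[_ MB] := Nsub _ NM.
  rewrite /= -[M _]/(M (S x - T x)); apply/set_mem; apply: MB; apply/mem_set.
    by apply: AS => //; exists x.
  by apply: AT => //; exists x.
- move=> S T; rewrite !inE => AS AT M NM _ [x Mx <-].
  by apply: (AS M NM); exists (T x) => //; apply: (AT M NM); exists x.
Qed.

End Nests.

(* Main.v *)
Require Import Defs.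
From mathcomp Require Import all_boot all_algebra.
From mathcomp Require Import boolp classical_sets.
From HB Require Import structures.

(** Write [x-] for [nest_pred N x].  It is a member of the nest, it omits [x]
    when [x <> 0], and every member of the nest either contains [x] or lies
    inside [x-].

    The radical lies in [A_-] for every nest.  The algebra [A] acts
    transitively modulo [x-]: a vector [y] outside [x-] is sent to [x] by the
    operator [z |-> f z *: x], where the functional [f] kills [x-] and is [1]
    at [y]; this operator respects the nest, because a member omitting [x] is
    contained in [x-] and hence killed ([Alg_transitive]).  Consequently, for
    [x <> 0], the operators of [A] sending [x] into [x-] form a maximal left
    ideal ([maximal_left_ideal_nest_pred]), and the intersection of these
    maximal left ideals is [A_-].

    Well-ordering is used for the converse.  For [T] in [A_-], the operator
    [1 - T] is injective because [T] strictly lowers every nonzero vector, and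
    it maps each member of the nest onto itself by induction along the nest:
    to solve [z - T z = y] it suffices to solve [w - T w = T y] in the smaller
    member [y-], which contains [T y], and to put [z = y + w].  So [1 - T] has
    an inverse in [A] ([strictly_triangular_quasi_regular]).  As [A_-] absorbs
    multiplication by [A] on the left, this applies to all the multiples of
    [T], and the usual quasi-regularity criterion puts [T] in the radical
    ([quasi_regular_jacobson]). *)

Set Implicit Arguments.
Unset Strict Implicit.
Unset Printing Implicit Defensive.

Import GRing.Theory.
Local Open Scope classical_set_scope.
Local Open Scope ring_scope.

(** * Quasi-regular elements and the Jacobson radical *)

Section QuasiRegular.
Context {R : pzRingType}.
Implicit Types A I : set R.

Lemma left_ideal_one A I : left_ideal A I -> I 1 -> I = A.
Proof.
move=> [IA _ _ IM] I1; apply/seteqP; split=> // a Aa.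
by rewrite -[a]mulr1; exact: IM.
Qed.

(** If a maximal left ideal [I] missed [t], then [I + A t] would be all of
    [A], so that [1 - a * t] would lie in [I] for some [a]; but this element
    has a left inverse. *)
Lemma quasi_regular_jacobson A (t : R) : subring_closed [in A] -> A t ->
  (forall a, A a -> exists2 b, A b & b * (1 - a * t) = 1) ->
  jacobson_radical A t.
Proof.
move=> [/set_mem A1 AB' AM'] At tqr.
have AB u v : A u -> A v -> A (u - v).
  by move=> Au Av; apply/set_mem/AB'; apply/mem_set.
have AM u v : A u -> A v -> A (u * v).
  by move=> Au Av; apply/set_mem/AM'; apply/mem_set.
have A0 : A 0 by rewrite -(subrr 1); exact: AB.
have AD u v : A u -> A v -> A (u + v).
  by move=> Au Av; rewrite -[v]opprK -[- v]add0r; apply/AB/AB.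
split=> // I [Ilid InA Imax]; have [IA I0 IB IM] := Ilid.
(* J is the left ideal I + A t. *)
pose J := [set u | exists i a, [/\ I i, A a & u = i + a * t]].
have Jlid : left_ideal A J.
  split.
  - by move=> _ [i [a [Ii Aa ->]]]; apply: AD; [exact: IA|exact: AM].
  - by exists 0, 0; split=> //; rewrite mul0r addr0.
  - move=> _ _ [i [a [Ii Aa ->]]] [j [b [Ij Ab ->]]].
    exists (i - j), (a - b); split; [exact: IB|exact: AB|].
    by rewrite mulrBl opprD addrACA.
  - move=> c _ Ac [i [a [Ii Aa ->]]].
    exists (c * i), (c * a); split; [exact: IM|exact: AM|].
    by rewrite mulrDr mulrA.
have IJ : I `<=` J.
  by move=> i Ii; exists i, 0; split=> //; rewrite mul0r addr0.
have [JI|JA] := Imax _ Jlid IJ.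
  by rewrite -JI; exists 0, 1; split=> //; rewrite mul1r add0r.
have [i [a [Ii Aa e1]]] : J 1 by rewrite JA.
have [b Ab be] := tqr _ Aa.
case: InA; apply: (left_ideal_one Ilid).
by rewrite -be e1 addrK; exact: IM.
Qed.

End QuasiRegular.

(** * Functionals separating a vector from a subspace *)

Section Subspaces.
Context {F : fieldType} {X : lmodType F}.
Implicit Types (M V H : set X) (x y z : X).

Lemma submod_closed_setP M : submod_closed [in M] <->
  M 0 /\ forall a x y, M x -> M y -> M (a *: x + y).
Proof.
split=> -[M0 Ml]; split.
- exact: set_mem.
- by move=> a x y Mx My; apply/set_mem/Ml; apply/mem_set.
- exact: mem_set.
- by move=> a x y /set_mem Mx /set_mem My; apply/mem_set/Ml.
Qed.

Lemma submod_setB M x y : submod_closed [in M] -> M x -> M y -> M (x - y).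
Proof.
by move=> /submod_closed_setP[_ Ml] Mx My; rewrite addrC -scaleN1r; exact: Ml.
Qed.

Lemma submod_setD M x y : submod_closed [in M] -> M x -> M y -> M (x + y).
Proof.
by move=> /submod_closed_setP[_ Ml] Mx My; rewrite -[x]scale1r; exact: Ml.
Qed.

Lemma submod_setZ M a x : submod_closed [in M] -> M x -> M (a *: x).
Proof.
by move=> /submod_closed_setP[M0 Ml] Mx; rewrite -[_ *: x]addr0; exact: Ml.
Qed.

Lemma linear_endo (g : X -> X) : linear g -> exists T : endo X, T =1 g.
Proof.
move=> glin; pose L := GRing.isLinear.Build F X X *:%R g glin.
pose T : {linear X -> X} := HB.pack g L.
by exists T.
Qed.

Lemma maximal_submod_avoiding V y : submod_closed [in V] -> ~ V y ->
  exists H, [/\ submod_closed [in H], V `<=` H, ~ H y &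
    forall H', submod_closed [in H'] -> H `<` H' -> H' y].
Proof.
move=> Vsub Vy; have [V0 Vl] := (submod_closed_setP V).1 Vsub.
(* Zorn's lemma is applied to the sets V `|` H rather than to the subspaces
     containing V, because the union of the empty chain is empty. *)
pose P H := submod_closed [in V `|` H] /\ ~ (V `|` H) y.
have [C CP Ctot|H [[Hsub Hy] Hmax]] := @Zorn_bigcup X P.
  split; last by case=> // -[H CH Hy]; case: (CP _ CH) => _; apply; right.
  have CU a H u v : C H -> (V `|` H) u -> (V `|` H) v ->
      (V `|` \bigcup_(K in C) K) (a *: u + v).
    move=> CH Hu Hv; have [/submod_closed_setP[_ Hl] _] := CP _ CH.
    by have [|?] := Hl a _ _ Hu Hv; [left|right; exists H].
  apply/submod_closed_setP; split; first by left.
  move=> a u v [Vu|[H CH Hu]] [Vv|[K CK Kv]].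
  - by left; exact: Vl.
  - by apply: (CU a K) => //; [left|right].
  - by apply: (CU a H) => //; [right|left].
  - have [HK|KH] := Ctot _ _ CH CK.
      by apply: (CU a K) => //; right => //; exact: HK.
    by apply: (CU a H) => //; right => //; exact: KH.
exists (V `|` H); split=> // H' H'sub [HH' H'neq].
have VH' : V `|` H' = H'.
  by apply/seteqP; split=> [u [Vu|//]|u]; [apply: HH'; left|right].
apply: contrapT => H'y; apply: (Hmax H'); last by split; rewrite VH'.
split=> [u Hu|H'H]; first by apply: HH'; right.
by apply: H'neq => u /H'H; right.
Qed.

(** A subspace [H] that is maximal among those containing [V] and omitting [y]
    is a complement of the line of [y]: if [z] is not in [H], then [y] is in
    [H + F z].  The functional is the coordinate along [y]. *)
Lemma separating_functional V y : submod_closed [in V] -> ~ V y ->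
  exists f : X -> F,
    [/\ scalar f, forall z, V z -> f z = 0 & f y = 1].
Proof.
move=> Vsub Vy; have [H [Hsub VH Hy Hmax]] := maximal_submod_avoiding Vsub Vy.
have [H0 Hl] := (submod_closed_setP H).1 Hsub.
have coord_uniq c d z : H (z - c *: y) -> H (z - d *: y) -> c = d.
  move=> Hc Hd; apply/eqP; rewrite -subr_eq0; apply/negP => /negP cd0.
  apply: Hy; rewrite -[y](scalerK cd0); apply: submod_setZ => //.
  have -> : (c - d) *: y = (z - d *: y) - (z - c *: y).
    by rewrite scalerBl opprB [RHS]addrC addrA subrK.
  exact: submod_setB.
have coord_ex z : exists c, H (z - c *: y).
  have [Hz|Hz] := pselect (H z); first by exists 0; rewrite scale0r subr0.
  (* H' is the sum of H and the line of z. *)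
  pose H' := [set u | exists a, H (u - a *: z)].
  have : H' y.
    apply: Hmax.
      apply/submod_closed_setP; split; first by exists 0; rewrite scale0r subr0.
      move=> a u v [b Hu] [c Hv]; exists (a * b + c).
      rewrite scalerDl -scalerA opprD addrACA -scalerBr.
      exact: Hl.
    split=> [u Hu|H'H]; first by exists 0; rewrite scale0r subr0.
    by apply/Hz/H'H; exists 1; rewrite scale1r subrr.
  move=> [a Hya]; have a0 : a != 0.
    by apply/eqP => a0; apply: Hy; rewrite a0 scale0r subr0 in Hya.
  exists a^-1; rewrite -[z](scalerK a0) -scalerBr; apply: submod_setZ => //.
  rewrite -opprB -[- _]add0r; exact: submod_setB.
have [f Hf] := choice coord_ex.
exists f; split=> [a u v|z Vz|].
- apply: (coord_uniq _ _ (a *: u + v)) => //.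
  by rewrite scalerDl -scalerA opprD addrACA -scalerBr; exact: Hl.
- apply: (coord_uniq _ _ z) => //.
  by rewrite scale0r subr0; exact: VH.
- by apply: (coord_uniq _ _ y) => //; rewrite scale1r subrr.
Qed.

End Subspaces.

(** * The algebra of a nest *)

Section NestAlgebra.
Context {F : fieldType} {X : lmodType F}.
Variable N : set (set X).
Hypothesis nestN : nest N.
Implicit Types (M : set X) (S T : endo X) (x y z : X).

Let Nsub M : N M -> submod_closed [in M].
Proof. by case: nestN => + _ _ _ _; apply. Qed.

Let N0 M : N M -> M 0.
Proof. by move=> /Nsub/submod_closed_setP[]. Qed.

Lemma nest_pred_nest x : N (nest_pred N x).
Proof. by case: nestN => _ _ _ _; apply=> M []. Qed.

Lemma nest_pred_irrefl x : nest_pred N x x -> x = 0.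
Proof. by case=> [//|[M [_ nMx] Mx]]. Qed.

Lemma nest_sub_pred M x : N M -> ~ M x -> M `<=` nest_pred N x.
Proof. by move=> NM nMx z Mz; right; exists M. Qed.

Lemma nest_pred_sub M x : N M -> M x -> nest_pred N x `<=` M.
Proof.
move=> NM Mx z [->|[M' [NM' nM'x] M'z]]; first exact: N0.
have [_ tot _ _ _] := nestN.
by have [M'M|MM'] := tot _ _ NM' NM; [exact: M'M|case: nM'x; exact: MM'].
Qed.

Lemma Alg_app T M x : Alg N T -> N M -> M x -> M (T x).
Proof. by move=> AT NM Mx; apply: (AT M NM); exists x. Qed.

Lemma AlgP T : (forall M x, N M -> M x -> M (T x)) -> Alg N T.
Proof. by move=> TM M NM _ [x Mx <-]; exact: TM. Qed.

Lemma Alg1 : Alg N 1.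
Proof. exact: AlgP. Qed.

Lemma AlgB S T : Alg N S -> Alg N T -> Alg N (S - T).
Proof.
have [_ AB _] := Alg_subring nestN.
by move=> AS AT; apply/set_mem/AB; apply/mem_set.
Qed.

Lemma AlgM S T : Alg N S -> Alg N T -> Alg N (S * T).
Proof.
have [_ _ AM] := Alg_subring nestN.
by move=> AS AT; apply/set_mem/AM; apply/mem_set.
Qed.

(** The rank-one operator [z |-> f z *: x], with [f] zero on [x-] and [1] at
    [y], respects a member of the nest containing [x] because its range is the
    line of [x], and any other member because it vanishes there. *)
Lemma Alg_transitive x y : ~ nest_pred N x y -> exists2 S, Alg N S & S y = x.
Proof.
move=> xy; have [f [flin f0 fy]] :=
  separating_functional (Nsub (nest_pred_nest x)) xy.
have [|S SE] := @linear_endo _ _ (fun z => f z *: x).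
  by move=> a u v; rewrite flin scalerDl scalerA.
exists S; last by rewrite SE fy scale1r.
apply: AlgP => M z NM Mz; rewrite SE.
have [Mx|nMx] := pselect (M x); first by apply: submod_setZ => //; exact: Nsub.
by rewrite f0 ?scale0r; [exact: N0|exact: nest_sub_pred Mz].
Qed.

(** An operator [T] outside this ideal has [T x] outside [x-], so some [S] in
    the algebra sends [T x] back to [x]; then [1 - S * T] kills [x], hence
    lies in the ideal, and [1] is in any left ideal containing both. *)
Lemma maximal_left_ideal_nest_pred x : x <> 0 ->
  maximal_left_ideal (Alg N) [set T | Alg N T /\ nest_pred N x (T x)].
Proof.
move=> x0; have Nx := nest_pred_nest x; split.
- split=> [T []//|||].
  + split; first by apply: AlgP => M z NM _; exact: N0.
    exact: N0.
  + move=> S T [AS Sx] [AT Tx]; split; first exact: AlgB.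
    by rewrite endoDE endoNE; apply: submod_setB => //; exact: Nsub.
  + move=> S T AS [AT Tx]; split; first exact: AlgM.
    by rewrite endoME; exact: Alg_app.
- move=> eA; have : Alg N 1 by exact: Alg1.
  by rewrite -eA => -[_ /nest_pred_irrefl].
- move=> J Jlid IJ; have [JA J0 JB JM] := Jlid.
  have [JI|/existsNP[T /not_implyP[JT nIT]]] :=
      pselect (J `<=` [set T | Alg N T /\ nest_pred N x (T x)]).
    by left; apply/seteqP.
  right; apply: left_ideal_one => //.
  have [|S AS Sx] := @Alg_transitive x (T x).
    by move=> Tx; apply: nIT; split=> //; exact: JA.
  have JST := JM _ _ AS JT.
  have JI1 : J (1 - S * T).
    apply: IJ; split; first by apply: AlgB; [exact: Alg1|exact: JA].
    have e0 : (1 - S * T) x = 0 by rewrite endoDE endoNE endo1E endoME Sx subrr.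
    by move: (N0 Nx); rewrite -e0.
  have := JB _ _ JI1 (JB _ _ J0 JST).
  by rewrite sub0r opprK subrK.
Qed.

Lemma jacobson_sub_strictly_triangular :
  jacobson_radical (Alg N) `<=` strictly_triangular N.
Proof.
move=> T [AT radT]; split=> // x; have [->|/eqP x0] := eqVneq x 0.
  by rewrite linear0; exact: N0 (nest_pred_nest 0).
by have [] := radT _ (maximal_left_ideal_nest_pred x0).
Qed.

Lemma strictly_triangularMl S T :
  Alg N S -> strictly_triangular N T -> strictly_triangular N (S * T).
Proof.
move=> AS [AT Tlow]; split=> [|x]; first exact: AlgM.
by rewrite endoME; apply: Alg_app => //; exact: nest_pred_nest.
Qed.

(** The difference [d = x - y] satisfies [T d = d], so [d] lies in [d-], which
    omits every nonzero [d]. *)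
Lemma strictly_triangular_inj T x y :
  strictly_triangular N T -> x - T x = y - T y -> x = y.
Proof.
move=> [_ Tlow] exy; apply/eqP; rewrite -subr_eq0; apply/eqP.
apply: nest_pred_irrefl; have := Tlow (x - y); rewrite linearB.
suff -> : T x - T y = x - y by [].
by move/eqP: exy; rewrite subr_eq addrAC -addrA addrC -subr_eq => /eqP <-.
Qed.

(** * Inverting [1 - T] along a well-ordered nest *)

Hypothesis woN : well_ordered N.

Lemma well_ordered_ind (P : set X -> Prop) :
  (forall M, N M -> (forall M', N M' -> M' `<=` M -> M' <> M -> P M') -> P M) ->
  forall M, N M -> P M.
Proof.
move=> IH M NM; apply: contrapT => nPM.
pose B := [set M | N M /\ ~ P M].
have [||K [[/set_mem[NK nPK] Kmin] _]] := woN (A := [in B]).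
- by move=> M' /set_mem[? _]; exact: mem_set.
- by exists M; exact: mem_set.
apply/nPK/IH => // M' NM' M'K neq; apply: contrapT => nPM'; apply: neq.
have /asboolP KM' : `[< K `<=` M' >] by apply: Kmin; exact: mem_set.
exact/seteqP.
Qed.

(** Solving inside each [M] separately is what makes the inverse of [1 - T]
    respect the nest.  In the induction step the equation for [y] in [M] is
    reduced to the one for [T y] in the strictly smaller member [y-]. *)
Lemma strictly_triangular_surj T : strictly_triangular N T ->
  forall M, N M -> forall y, M y -> exists2 z, M z & z - T z = y.
Proof.
move=> [AT Tlow]; apply: well_ordered_ind => M NM IH y My.
have [->|/eqP y0] := eqVneq y 0.
  by exists 0; [exact: N0|rewrite linear0 subr0].
have yM := nest_pred_sub NM My.
have [|w yw ew] := IH _ (nest_pred_nest y) yM _ _ (Tlow y).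
  by move=> eM; apply/y0/nest_pred_irrefl; rewrite eM.
exists (y + w).
  by apply: submod_setD; [exact: Nsub|exact: My|exact: yM].
by rewrite linearD opprD addrACA ew subrK.
Qed.

Lemma strictly_triangular_quasi_regular T : strictly_triangular N T ->
  exists2 S, Alg N S & S * (1 - T) = 1.
Proof.
move=> sT; have surj := strictly_triangular_surj sT.
have [_ _ [_ NX] _ _] := nestN.
have [g gE] := choice (fun y =>
  let: ex_intro2 z _ e := surj _ NX y I in ex_intro _ z e).
have gK z : g (z - T z) = z by apply: (strictly_triangular_inj sT); rewrite gE.
have [a u v|S SE] := @linear_endo _ _ g.
  apply: (strictly_triangular_inj sT); rewrite gE linearP opprD addrACA.
  by rewrite -scalerBr !gE.
exists S; last first.
  by apply: endoP => x; rewrite endoME endoDE endoNE !endo1E SE gK.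
apply: AlgP => M y NM My; rewrite SE.
by have [z Mz <-] := surj _ NM _ My; rewrite gK.
Qed.

End NestAlgebra.

Theorem corollary23 (F : fieldType) (X : lmodType F) (N : set (set X)) :
  nest N -> well_ordered N ->
  jacobson_radical (Alg N) = strictly_triangular N.
Proof.
move=> nestN woN; apply/seteqP; split.
  exact: jacobson_sub_strictly_triangular.
move=> T sT; apply: quasi_regular_jacobson (Alg_subring nestN) sT.1 _ => S AS.
apply: strictly_triangular_quasi_regular => //.
exact: strictly_triangularMl.
Qed.
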